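(* Each of the following five $8$-dimensional complex Lie algebras is indecomposable (not a direct sum of two nonzero ideals). Each has basis $\mathbf x_1,\dots,\mathbf x_6,\mathbf y_1,\mathbf y_2$, with the listed nonzero brackets (together with those obtained by antisymmetry) and all other brackets of basis elements equal to zero: (1) $N^{8,2}_1$: $[\mathbf x_1,\mathbf x_2]=\mathbf y_1$, $[\mathbf x_3,\mathbf x_4]=\mathbf y_2$, $[\mathbf x_5,\mathbf x_6]=\mathbf y_1+\mathbf y_2$; (2) $N^{8,2}_2$: $[\mathbf x_5,\mathbf x_2]=[\mathbf x_6,\mathbf x_1]=\mathbf y_1$, $[\mathbf x_5,\mathbf x_3]=[\mathbf x_6,\mathbf x_4]=\mathbf y_2$; (3) $N^{8,2}_3$: $[\mathbf x_1,\mathbf x_2]=[\mathbf x_6,\mathbf x_5]=\mathbf y_1$, $[\mathbf x_3,\mathbf x_6]=[\mathbf x_5,\mathbf x_4]=\mathbf y_2$; (4) $N^{8,2}_4$: $[\mathbf x_1,\mathbf x_2]=[\mathbf x_3,\mathbf x_6]=[\mathbf x_5,\mathbf x_4]=\mathbf y_1$, $[\mathbf x_6,\mathbf x_5]=\mathbf y_2$; (5) $N^{8,2}_5$: $[\mathbf x_1,\mathbf x_6]=[\mathbf x_3,\mathbf x_4]=[\mathbf x_5,\mathbf x_2]=\mathbf y_1$, $[\mathbf x_6,\mathbf x_3]=[\mathbf x_4,\mathbf x_5]=\mathbf y_2$. *)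

(* Defs.v *)
From HB Require Import structures.
From mathcomp Require Import all_boot all_order all_algebra.
From mathcomp Require Import complex.
From mathcomp Require Import Rstruct.
From Stdlib Require Rdefinitions.
Set Implicit Arguments. Unset Strict Implicit. Unset Printing Implicit Defensive.
Import Order.TTheory GRing.Theory Num.Theory.
Local Open Scope ring_scope.

Definition CC : Type := complex Rdefinitions.R.

Definition ebas (n : nat) (i : nat) : 'rV[CC]_n.+1 := delta_mx 0 (inord i).

(* A bracket table: a list of triples (i, j, v) meaning [e_i, e_j] = v
   (and hence [e_j, e_i] = - v by antisymmetry); all unlisted brackets of
   basis elements are zero. *)
Definition table (n : nat) := seq (nat * nat * 'rV[CC]_n.+1).

Definition sconst n (t : table n) (i j : 'I_n.+1) : 'rV[CC]_n.+1 :=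
  \sum_(e <- t)
     ((((e.1.1 == i :> nat) && (e.1.2 == j :> nat))%:R
       - ((e.1.1 == j :> nat) && (e.1.2 == i :> nat))%:R) *: e.2).

Definition lbr n (t : table n) (u v : 'rV[CC]_n.+1) : 'rV[CC]_n.+1 :=
  \sum_(i < n.+1) \sum_(j < n.+1) (u 0 i * v 0 j) *: sconst t i j.

Definition is_ideal n (t : table n) (I : 'M[CC]_n.+1) : Prop :=
  forall u v : 'rV[CC]_n.+1, (u <= I)%MS -> (lbr t u v <= I)%MS.

Definition indecomposable n (t : table n) : Prop :=
  ~ exists I J : 'M[CC]_n.+1,
      [/\ is_ideal t I, is_ideal t J, I != 0, J != 0 &
          (mxdirect (I + J) /\ (I + J == 1%:M)%MS)].

(* Basis: x_1..x_6 = e_0..e_5, y_1 = e_6, y_2 = e_7 in C^8. *)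
Definition x (k : nat) : nat := k.-1.
Definition y1 : 'rV[CC]_8 := ebas 7 6.
Definition y2 : 'rV[CC]_8 := ebas 7 7.

Definition N1 : table 7 :=
  [:: (x 1, x 2, y1); (x 3, x 4, y2); (x 5, x 6, y1 + y2)].
Definition N2 : table 7 :=
  [:: (x 5, x 2, y1); (x 6, x 1, y1); (x 5, x 3, y2); (x 6, x 4, y2)].
Definition N3 : table 7 :=
  [:: (x 1, x 2, y1); (x 6, x 5, y1); (x 3, x 6, y2); (x 5, x 4, y2)].
Definition N4 : table 7 :=
  [:: (x 1, x 2, y1); (x 3, x 6, y1); (x 5, x 4, y1); (x 6, x 5, y2)].
Definition N5 : table 7 :=
  [:: (x 1, x 6, y1); (x 3, x 4, y1); (x 5, x 2, y1);
      (x 6, x 3, y2); (x 4, x 5, y2)].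

(* Main.v *)
(** If L is the direct sum of ideals I and J, the projection P onto I along J
    is an idempotent of the centroid: [uP, v] = [u, v]P.  In each of the five
    algebras, comparing a few brackets shows that an element P of the centroid
    acts on the centre <y1, y2> by a triangular matrix with a single eigenvalue
    a.  If P is idempotent, then a is 0 or 1 and this matrix is scalar; up to
    exchanging P with 1 - P it is zero.  Then [uP, v] = [u, v]P = 0 for all
    u, v, so uP is central and uP = uPP = 0. *)
Set Implicit Arguments.
Unset Strict Implicit.
Unset Printing Implicit Defensive.
Require Import Defs.
From mathcomp Require Import all_boot all_order all_algebra.
From mathcomp Require Import complex Rstruct.
Import GRing.Theory.
Local Open Scope ring_scope.

Section Bracket.
Variable n : nat.
Implicit Types (t : table n) (u v : 'rV[CC]_n.+1) (P I J : 'M[CC]_n.+1).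

Lemma lbrDl t u1 u2 v : lbr t (u1 + u2) v = lbr t u1 v + lbr t u2 v.
Proof.
rewrite /lbr -big_split; apply: eq_bigr => i _ /=.
rewrite -big_split; apply: eq_bigr => j _ /=.
by rewrite mxE mulrDl scalerDl.
Qed.

Lemma lbr0l t v : lbr t 0 v = 0.
Proof. by apply: (addrI (lbr t 0 v)); rewrite -lbrDl !addr0. Qed.

Lemma lbrNl t u v : lbr t (- u) v = - lbr t u v.
Proof. by apply: (addrI (lbr t u v)); rewrite -lbrDl !subrr lbr0l. Qed.

Lemma ebasE i j : (i <= n)%N -> (j <= n)%N ->
  ebas n i 0 (inord j) = (i == j)%:R.
Proof. by move=> le_i le_j; rewrite mxE eqxx -val_eqE /= !inordK // eq_sym. Qed.

Lemma lbr_sub t u v m (A : 'M[CC]_(m, n.+1)) :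
  (forall e, e \in t -> (e.2 <= A)%MS) -> (lbr t u v <= A)%MS.
Proof.
move=> tA; apply: summx_sub => i _; apply: summx_sub => j _; apply: scalemx_sub.
rewrite /sconst big_seq; apply: summx_sub => e /tA; exact: scalemx_sub.
Qed.

(** This makes brackets computable: simplification evaluates the sum over the table even when [u] is
    an unknown row. The bounds matter because [inord] sends out-of-range indices to 0. *)
Lemma lbr_ebas t u k : (k <= n)%N ->
  all (fun e => (e.1.1 <= n)%N && (e.1.2 <= n)%N) t ->
  lbr t u (ebas n k) =
  \sum_(e <- t) (u 0 (inord e.1.1) *+ (e.1.2 == k)
                 - u 0 (inord e.1.2) *+ (e.1.1 == k)) *: e.2.
Proof.
move=> le_k /allP le_t; rewrite /lbr.
under eq_bigr => i _.
  rewrite (bigD1 (inord k)) //= ebasE // eqxx mulr1 big1 ?addr0; last first.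
    by move=> j kj; rewrite mxE (negPf kj) andbF mulr0 scale0r.
  rewrite /sconst scaler_sumr; over.
rewrite exchange_big /= big_seq [RHS]big_seq.
apply: eq_bigr => -[[a b] w] /le_t /andP[/= le_a le_b].
under eq_bigr => i _ do rewrite scalerA inordK //.
rewrite -scaler_suml; congr (_ *: _).
have pick c (P : bool) : (c <= n)%N ->
    \sum_(i < n.+1) u 0 i * ((c == i) && P)%:R = u 0 (inord c) *+ P.
  move=> le_c; rewrite (bigD1 (inord c)) //= inordK // eqxx big1 ?addr0.
    by rewrite mulr_natr.
  move=> i; rewrite -val_eqE /= inordK // eq_sym => /negPf->.
  by rewrite mulr0.
rewrite -(pick a) // -(pick b) // -sumrB; apply: eq_bigr => i _.
by rewrite mulrBr [_ && (b == i :> nat)]andbC.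
Qed.

(** Testing the first argument suffices: [lbr] is antisymmetric, so [P] passes through the second
    one too. *)
Definition centroid t P := forall u v, lbr t (u *m P) v = lbr t u v *m P.

Lemma centroid_opp1 t P : centroid t P -> centroid t (1%:M - P).
Proof. by move=> cP u v; rewrite !mulmxBr !mulmx1 lbrDl lbrNl cP. Qed.

(** Split u = a + b along I and J. Since [a, v] lies in I and [b, v] in J, both sides equal
    [a, v]. *)
Lemma centroid_proj t I J : is_ideal t I -> is_ideal t J ->
  (I :&: J = 0)%MS -> (1%:M <= I + J)%MS -> centroid t (proj_mx I J).
Proof.
move=> idI idJ IJ0 IJ1 u v.
have /sub_addsmxP[[u1 u2] /= ->] := submx_trans (submx1 u) IJ1.
move: (u1 *m I) (u2 *m J) (submxMl u1 I) (submxMl u2 J) => a b aI bJ.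
rewrite [in LHS]mulmxDl (proj_mx_id IJ0 aI) (proj_mx_0 IJ0 bJ) addr0 lbrDl.
move: (idI a v aI) (idJ b v bJ) => {}aI {}bJ.
by rewrite mulmxDl (proj_mx_id IJ0 aI) (proj_mx_0 IJ0 bJ) addr0.
Qed.

Lemma indecomposable_centroid t :
  (forall P, P *m P = P -> centroid t P -> P = 0 \/ P = 1%:M) ->
  indecomposable t.
Proof.
move=> idem01 [I [J [idI idJ I0 J0 [/mxdirect_addsP IJ0 /andP[_ IJ1]]]]].
have [||P0|P1] := idem01 (proj_mx I J).
- by apply: proj_mx_proj.
- exact: centroid_proj.
- by case/eqP: I0; rewrite -(proj_mx_id IJ0 (submx_refl I)) P0 mulmx0.
- by case/eqP: J0; rewrite -(proj_mx_0 IJ0 (submx_refl J)) P1 mulmx1.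
Qed.

End Bracket.


Lemma y_free (a b c d : CC) :
  a *: y1 + b *: y2 = c *: y1 + d *: y2 -> a = c /\ b = d.
Proof.
have coord i (p q : CC) : (i <= 7)%N ->
    (p *: y1 + q *: y2) 0 (inord i) = p * (6 == i)%:R + q * (7 == i)%:R.
  by move=> le_i; rewrite mxE [(p *: y1) _ _]mxE [(q *: y2) _ _]mxE !ebasE.
move=> /rowP E; have := E (inord 6); have := E (inord 7); rewrite !coord //=.
by rewrite !mulr1 !mulr0 !addr0 !add0r.
Qed.

Lemma sub_y (u : 'rV[CC]_8) :
  (forall i, (i < 6)%N -> u 0 (inord i) = 0) -> (u <= y1 + y2)%MS.
Proof.
move=> u0; rewrite [u]row_sum_delta; apply: summx_sub => j _.
have [j6|j6] := ltnP j 6; first by rewrite -(inord_val j) u0 // scale0r sub0mx.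
apply: scalemx_sub; rewrite -(inord_val j); have := ltn_ord j.
move: (j : nat) j6 => [|[|[|[|[|[|[|[|k]]]]]]]] // _ _.
- exact: addsmxSl.
- exact: addsmxSr.
Qed.

(** The second hypothesis confines the centre to <y1, y2>, by brackets with x_1, ..., x_6 alone. The
    third allows an off-diagonal c, which [N4] and [N5] require. *)
Lemma indecomposable_y (t : table 7) :
  (forall e, e \in t -> (e.2 <= y1 + y2)%MS) ->
  (forall u, (forall k, (k < 6)%N -> lbr t u (ebas 7 k) = 0) ->
   forall i, (i < 6)%N -> u 0 (inord i) = 0) ->
  (forall P, centroid t P ->
     exists a c, y1 *m P = a *: y1 /\ y2 *m P = a *: y2 + c *: y1) ->
  indecomposable t.
Proof.
move=> t_sub centre_sub centroid_y; apply: indecomposable_centroid.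
have P0 P : P *m P = P -> centroid t P -> y1 *m P = 0 -> y2 *m P = 0 -> P = 0.
  move=> PP cP y1P y2P.
  have yP m (A : 'M_(m, _)) : (A <= y1 + y2)%MS -> A *m P = 0.
    move=> /submx_trans-/(_ _ (kermx P)) sA; apply/sub_kermxP/sA.
    by rewrite addsmx_sub !sub_kermx y1P y2P eqxx.
  apply/row_matrixP => i; rewrite row0 -PP row_mul yP //.
  apply/sub_y/centre_sub => k _.
  by rewrite rowE cP yP // lbr_sub.
move=> P PP cP; have [a [c [y1P y2P]]] := centroid_y P cP.
(* Compare y1 P P with y1 P; [0 = 0] is the y2-coordinate that [y_free] asks for. *)
have [aa _] : a * a = a /\ 0 = 0 :> CC.
  apply: y_free; rewrite !scale0r !addr0 -scalerA -[in LHS]y1P.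
  by rewrite scalemxAl -y1P -mulmxA PP.
(* Compare y2 P P with y2 P: the y1-coordinate 2ac = c forces c = 0 both for a = 0 and for a = 1. *)
have [cc _] : a * c + c * a = c /\ a * a = a.
  apply: y_free; rewrite [c *: _ + _]addrC -y2P -{1}PP mulmxA y2P mulmxDl.
  rewrite -!scalemxAl y1P y2P scalerDr !scalerA scalerDl.
  by rewrite [LHS]addrC addrA.
have /orP[/eqP a0|/eqP a1] : (a == 0) || (a == 1).
- by rewrite -[a == 1]subr_eq0 -mulf_eq0 mulrBr mulr1 aa subrr.
- have c0 : c = 0 by rewrite -cc a0 mul0r mulr0 addr0.
  by left; apply: P0; rewrite ?y1P ?y2P ?a0 ?c0 ?scale0r ?addr0.
- have c0 : c = 0.
    by move: cc; rewrite a1 mul1r mulr1 => /(canRL (addrK c)); rewrite subrr.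
  right; apply/esym/eqP; rewrite -subr_eq0; apply/eqP/P0.
  + by rewrite mulmxBr mulmx1 mulmxBl mul1mx PP subrr subr0.
  + exact: centroid_opp1.
  + by rewrite mulmxBr mulmx1 y1P a1 scale1r subrr.
  + by rewrite mulmxBr mulmx1 y2P a1 c0 scale1r scale0r addr0 subrr.
Qed.

Lemma y_eq0 (a b : CC) : (a *: y1 + b *: y2 == 0) = (a == 0) && (b == 0).
Proof.
apply/eqP/andP => [ab0|[/eqP-> /eqP->]]; last by rewrite !scale0r addr0.
have [-> ->] : a = 0 /\ b = 0 by apply: y_free; rewrite ab0 !scale0r addr0.
by [].
Qed.

Lemma y1_eq0 (a : CC) : (a *: y1 == 0) = (a == 0).
Proof. by have := y_eq0 a 0; rewrite scale0r addr0 eqxx andbT. Qed.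

Lemma y2_eq0 (a : CC) : (a *: y2 == 0) = (a == 0).
Proof. by have := y_eq0 0 a; rewrite scale0r add0r eqxx. Qed.

Lemma y12_eq0 (a : CC) : (a *: (y1 + y2) == 0) = (a == 0).
Proof. by rewrite scalerDr y_eq0 andbb. Qed.

Ltac expand_bracket :=
  rewrite ?lbr_ebas ?unlock //= ?ebasE //=
    ?(mulr0n, mulr1n, subr0, sub0r, scale0r, add0r, addr0, scale1r, scaleN1r).

Ltac values_in_y :=
  apply/allP; rewrite /= ?addmx_sub ?addsmxSl ?addsmxSr.

Ltac coordinate_by_bracket u0 k :=
  move/eqP: (u0 k isT); expand_bracket;
  rewrite ?y_eq0 ?y1_eq0 ?y2_eq0 ?y12_eq0 ?oppr_eq0;
  first [by [] | by case/andP].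

(** In each table, every coordinate of u along x_1, ..., x_6 is, up to sign, a coefficient of some
    [u, x_k], so a search over k finds it. *)
Ltac trivial_mod_y :=
  let u0 := fresh in
  move=> u u0 [|[|[|[|[|[|i]]]]]] // _; apply/eqP;
  first [coordinate_by_bracket u0 0%N | coordinate_by_bracket u0 1%N
       | coordinate_by_bracket u0 2%N | coordinate_by_bracket u0 3%N
       | coordinate_by_bracket u0 4%N | coordinate_by_bracket u0 5%N].

Lemma N1_indecomposable : indecomposable N1.
Proof.
apply: indecomposable_y; [by values_in_y | by trivial_mod_y | move=> P cP].
have := cP (ebas 7 (x 1)) (ebas 7 (x 2)); expand_bracket => aE.
have := cP (ebas 7 (x 3)) (ebas 7 (x 4)); expand_bracket => bE.
have := cP (ebas 7 (x 5)) (ebas 7 (x 6)); expand_bracket => cE.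
(* y1, y2 and y1 + y2 are all eigenvectors of [P], hence share one eigenvalue. *)
move: cE; rewrite scalerDr mulmxDl -aE -bE => /y_free[<- <-].
by eexists _, 0; rewrite scale0r addr0.
Qed.

Lemma N2_indecomposable : indecomposable N2.
Proof.
apply: indecomposable_y; [by values_in_y | by trivial_mod_y | move=> P cP].
have := cP (ebas 7 (x 5)) (ebas 7 (x 2)); expand_bracket => aE.
have := cP (ebas 7 (x 5)) (ebas 7 (x 3)); expand_bracket => bE.
(* x_2 and x_3 bracket only with x_5, so both eigenvalues are the x_5-coordinate of x_5 P. *)
by eexists _, 0; rewrite -aE -bE scale0r addr0.
Qed.

Lemma N3_indecomposable : indecomposable N3.
Proof.
apply: indecomposable_y; [by values_in_y | by trivial_mod_y | move=> P cP].
have := cP (ebas 7 (x 1)) (ebas 7 (x 2)); expand_bracket => aE.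
have := cP (ebas 7 (x 6)) (ebas 7 (x 5)); expand_bracket => bE.
have := cP (ebas 7 (x 6)) (ebas 7 (x 3)); expand_bracket => cE.
move: cE; rewrite mulNmx scaleNr => /oppr_inj cE.
(* Two expressions for y1 P: the eigenvalue from [x_1, x_2] equals the x_6-coordinate of x_6 P,
   which by [cE] is the eigenvalue on y2. *)
move: bE; rewrite -aE -[RHS]addr0 -(scale0r y2) => /y_free[ba _].
by eexists _, 0; split; [| rewrite -cE ba scale0r addr0].
Qed.

Lemma N4_indecomposable : indecomposable N4.
Proof.
apply: indecomposable_y; [by values_in_y | by trivial_mod_y | move=> P cP].
have := cP (ebas 7 (x 6)) (ebas 7 (x 3)); expand_bracket => aE.
have := cP (ebas 7 (x 6)) (ebas 7 (x 5)); expand_bracket => bE.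
move: aE; rewrite mulNmx scaleNr => /oppr_inj aE.
(* a is the x_6-coordinate of x_6 P. As x_5 brackets with x_4 too, c is minus the x_4-coordinate of
   x_6 P. *)
by do 2 eexists; split; [exact/esym/aE | rewrite -bE addrC].
Qed.

Lemma N5_indecomposable : indecomposable N5.
Proof.
apply: indecomposable_y; [by values_in_y | by trivial_mod_y | move=> P cP].
have := cP (ebas 7 (x 6)) (ebas 7 (x 1)); expand_bracket => aE.
have := cP (ebas 7 (x 6)) (ebas 7 (x 3)); expand_bracket => bE.
move: aE; rewrite mulNmx scaleNr => /oppr_inj aE.
(* Same a and c as for [N4]; here c arises from [x_3, x_4] = y1. *)
by do 2 eexists; split; [exact/esym/aE | rewrite -bE addrC].
Qed.

Theorem theorem5 :
  [/\ indecomposable N1, indecomposable N2, indecomposable N3,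
      indecomposable N4 & indecomposable N5].
Proof.
split; [exact: N1_indecomposable | exact: N2_indecomposable
  | exact: N3_indecomposable | exact: N4_indecomposable
  | exact: N5_indecomposable].
Qed.
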